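(* Let $J=(q_i)_{i\ge1}$ be a sequence of pairwise relatively prime non-negative integers, and let $I=(a_j)_{j\ge1}$ be a sequence with every $a_j\in J$ and each $q_i$ appearing infinitely many times in $I$. Let $\mathfrak{n}=\prod_{k\ge1}q_k^{\infty}$. Then for every infinite generalized integer $\mathfrak{m}$ coprime with $\mathfrak{n}$ there exists a simple Riesz group of rank one $G(\mathfrak{m})$ such that: (i) for every $q_i$ there is a countably generated interval $D_i\subseteq G(\mathfrak{m})^+$ with $tD_i\neq G(\mathfrak{m})^+$ for every positive integer $t\le q_i-1$ and $q_iD_i=G(\mathfrak{m})^+$; (ii) $G(\mathfrak{m})$ is isomorphic, as an abelian group, to $\mathbb{Z}_{\mathfrak{n}\cdot\mathfrak{m}}$.
   Context: Partially ordered abelian group $(G,G^+)$; simple: $G\neq0$ and every nonzero $u\in G^+$ is an order-unit. Riesz group: $x\le y_1+y_2$ in $G^+$ implies $x=x_1+x_2$ with $x_j\in G^+$, $x_j\le y_j$. Rank one: isomorphic to a nonzero subgroup of $\mathbb{Q}$. A generalized integer is a map $\mathfrak{n}$ from the primes to $\{0,1,\dots,\infty\}$, written $\prod_p p^{\mathfrak{n}(p)}$; $\prod_k q_k^\infty$ is the one taking value $\infty$ at each prime dividing some $q_k$ and $0$ elsewhere. It is finite if it never takes $\infty$ and is nonzero at finitely many primes, infinite otherwise; products add exponents; $\mathfrak{n},\mathfrak{m}$ coprime means for each prime one of the exponents is $0$. $\mathbb{Z}_{\mathfrak{n}}=\{a/b\in\mathbb{Q}: a\in\mathbb{Z},\ b\mid\mathfrak{n}\}$.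 An interval in $G^+$ is a nonempty, upward directed, order-hereditary subset of $G^+$; it is countably generated if it has a countable cofinal subset. $X+Y=\{z\in G^+: z\le x+y,\ x\in X,\ y\in Y\}$, $tX$ the $t$-fold sum. *)

(* Defs.v *)
From HB Require Import structures.
From mathcomp Require Import all_boot all_order all_algebra.
From Stdlib Require Import ClassicalEpsilon.
Set Implicit Arguments. Unset Strict Implicit. Unset Printing Implicit Defensive.
Import Order.TTheory GRing.Theory Num.Theory.
Local Open Scope ring_scope.

Definition is_cone (G : zmodType) (P : G -> Prop) : Prop :=
  [/\ P 0, (forall x y, P x -> P y -> P (x + y)) &
      (forall x, P x -> P (- x) -> x = 0)].

Definition pleq (G : zmodType) (P : G -> Prop) (x y : G) : Prop := P (y - x).

Definition order_unit (G : zmodType) (P : G -> Prop) (u : G) : Prop :=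
  P u /\ forall x : G, exists n : nat, pleq P x (u *+ n).

Definition simple_pog (G : zmodType) (P : G -> Prop) : Prop :=
  (exists x : G, x <> 0) /\ forall u, P u -> u <> 0 -> order_unit P u.

Definition riesz (G : zmodType) (P : G -> Prop) : Prop :=
  forall x y1 y2, P x -> P y1 -> P y2 -> pleq P x (y1 + y2) ->
    exists x1 x2, [/\ P x1, P x2, pleq P x1 y1, pleq P x2 y2 & x = x1 + x2].

Definition additive_map (G H : zmodType) (f : G -> H) : Prop :=
  forall x y, f (x + y) = f x + f y.

Definition rank_one (G : zmodType) : Prop :=
  exists f : G -> rat, [/\ additive_map f, injective f & exists x, f x <> 0].

Definition pog_interval (G : zmodType) (P : G -> Prop) (X : G -> Prop) : Prop :=
  [/\ (forall x, X x -> P x),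
      (exists x, X x),
      (forall x y, X x -> X y -> exists z, [/\ X z, pleq P x z & pleq P y z]) &
      (forall z x, P z -> pleq P z x -> X x -> X z)].

(* countably generated: there is a countable cofinal subset (given as the
   range of a sequence; the interval is nonempty so this loses nothing) *)
Definition countably_generated (G : zmodType) (P : G -> Prop) (X : G -> Prop) :=
  exists s : nat -> G, (forall n, X (s n)) /\ forall x, X x -> exists n, pleq P x (s n).

Definition isum (G : zmodType) (P : G -> Prop) (X Y : G -> Prop) : G -> Prop :=
  fun z => P z /\ exists x y, [/\ X x, Y y & pleq P z (x + y)].

(* t-fold sum tX (1X = X, (t+1)X = X + tX; 0X = {0} is a convention never used
   with t = 0 in a non-vacuous way) *)
Fixpoint tmul (G : zmodType) (P : G -> Prop) (t : nat) (X : G -> Prop) : G -> Prop :=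
  match t with
  | 0%N => fun z => z = 0
  | 1%N => X
  | S t' => isum P X (tmul P t' X)
  end.

Definition same_set (G : Type) (X Y : G -> Prop) : Prop := forall z, X z <-> Y z.

(* gint n : p |-> exponent at p, with None standing for infinity.
   Only values at primes are meaningful. *)
Definition gint := nat -> option nat.

Definition gint_finite (n : gint) : Prop :=
  (forall p, prime p -> n p <> None) /\
  exists N : nat, forall p, prime p -> (N <= p)%N -> n p = Some 0%N.

Definition gint_infinite (n : gint) : Prop := ~ gint_finite n.

Definition gint_mul (n m : gint) : gint := fun p =>
  match n p, m p with Some a, Some b => Some (a + b)%N | _, _ => None end.

Definition gint_coprime (n m : gint) : Prop :=
  forall p, prime p -> n p = Some 0%N \/ m p = Some 0%N.

Definition gint_inf_prod (q : nat -> nat) : gint := fun p =>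
  if excluded_middle_informative (exists k, (p %| q k)%N) then None else Some 0%N.

Definition gdvd (b : nat) (n : gint) : Prop :=
  (0 < b)%N /\ forall p, prime p ->
    match n p with None => True | Some e => is_true (logn p b <= e)%N end.

Definition Zg (n : gint) (x : rat) : Prop :=
  exists (a : int) (b : nat), gdvd b n /\ x = a%:~R / b%:R.

Definition iso_Zg (G : zmodType) (n : gint) : Prop :=
  exists f : G -> rat, [/\ additive_map f, injective f &
    forall r, Zg n r <-> exists x, f x = r].

(* Main.v *)
(* Write [l] for [n * m].  The cone on [Z_l] is the union of an increasing sequence of
   submonoids [S] of [(1/N)Z], each containing every large element of [(1/N)Z]; along
   the way the generators [d_i] of the intervals increase, subject to
   [t d_i - 1 \notin S] for [0 < t < q_i].  A countable list of tasks is met one by one: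
   - to make [q_i d_i] dominate a given [x], replace [d_i] by [d_i + e] with [e] large
     and of order exactly [q_i] modulo [(1/N)Z]: then [t (d_i + e) - 1 = s + j e] with
     [t < q_i] forces [j = t + k q_i], so [t d_i - 1] would already lie in [S];
   - to refine [x <= y1 + y2], adjoin [a, x - a, y1 - a, y2 - x + a] with [a] of order
     exactly [r] modulo [(1/N)Z]: a sum of these lying in [(1/N)Z] either is
     balanced, hence in [S], or has at least [r] terms, hence is large.  Large [r] are
     available because [l] is infinite. *)
Require Import Defs.
From HB Require Import structures.
From mathcomp Require Import all_boot all_order all_algebra.
From mathcomp Require Import lra ring zify.
From Stdlib Require Import Classical ClassicalEpsilon.
Set Implicit Arguments. Unset Strict Implicit. Unset Printing Implicit Defensive.
Import Order.TTheory GRing.Theory Num.Theory.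
Local Open Scope ring_scope.

(** * Divisors of generalized integers *)

Lemma gdvd1 (l : gint) : gdvd 1 l.
Proof. by split=> // p _; rewrite logn1; case: (l p). Qed.

Lemma gdvd_lcm (b c : nat) (l : gint) :
  gdvd b l -> gdvd c l -> gdvd (lcmn b c) l.
Proof.
move=> [b0 lb] [c0 lc]; split=> [|p pp]; first by rewrite lcmn_gt0 b0.
have := lb p pp; have := lc p pp; rewrite logn_lcm //; case: (l p) => // e ec eb.
by rewrite geq_max eb.
Qed.

Lemma gdvd_mul_infinite (b c : nat) (l : gint) : gdvd b l -> (0 < c)%N ->
  (forall p, prime p -> (p %| c)%N -> l p = None) -> gdvd (b * c) l.
Proof.
move=> [b0 lb] c0 lc; split=> [|p pp]; first by rewrite muln_gt0 b0.
case: (boolP (p %| c)%N) => [/(lc p pp)->//|pc].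
by rewrite lognM // (lognE p c) (negbTE pc) !andbF addn0; exact: lb.
Qed.

(** If some exponent is infinite, a power of that prime serves as [r]. Otherwise infinitely many
    primes have nonzero exponent, and one beyond [r0 + b] is coprime to [b], so it may be used
    once. *)
Lemma gdvd_mul_large (l : gint) (b r0 : nat) : gint_infinite l -> gdvd b l ->
  exists2 r, (r0 < r)%N & gdvd (b * r) l.
Proof.
move=> linf lb.
have [[p [pp lp]]|nolp] := classic (exists p, prime p /\ l p = None).
  exists (p ^ r0)%N; first exact: ltn_expl (prime_gt1 pp).
  apply: gdvd_mul_infinite => //; first by rewrite expn_gt0 prime_gt0.
  by move=> p' pp'; rewrite Euclid_dvdX // dvdn_prime2 // => /andP[/eqP-> _].
have [p [pp ltp lp]] : exists p, [/\ prime p, (r0 + b < p)%N & l p <> Some 0%N].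
  apply: NNPP => nop; apply: linf; split=> [p pp lp|]; first by apply: nolp; exists p.
  exists (r0 + b).+1 => p pp ltp; apply: NNPP => lp; apply: nop; by exists p.
exists p; first by lia.
case: lb => b0 lb; split=> [|p' pp']; first by rewrite muln_gt0 b0 prime_gt0.
rewrite lognM ?(prime_gt0 pp) // (logn_prime p' pp).
have := lb p' pp'; case: eqP => [->|_]; last by rewrite addn0.
case: (l p) lp => // -[//|e] _ _.
by rewrite lognE pp b0 /= gtnNdvd //; lia.
Qed.

(** * The groups (1/N)Z *)

Definition lattice (N : nat) : {pred rat} := [pred x | x * N%:R \is a Num.int].

Lemma lattice_zmod_closed N : zmod_closed (lattice N).
Proof.
split=> [|x y]; first by rewrite inE mul0r int_num0.
by rewrite !inE mulrBl => xN yN; rewrite rpredB.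
Qed.

HB.instance Definition _ N := GRing.isZmodClosed.Build rat (lattice N) (lattice_zmod_closed N).

Lemma lattice_dvd N M x : (N %| M)%N -> x \in lattice N -> x \in lattice M.
Proof.
move=> /dvdnP[k ->]; rewrite !inE mulnC natrM mulrA => xN.
by rewrite rpredM ?natr_int.
Qed.

Lemma lattice1 N : 1 \in lattice N.
Proof. by rewrite inE mul1r natr_int. Qed.

Lemma lattice_frac N (z : int) : (0 < N)%N -> z%:~R / N%:R \in lattice N.
Proof. by move=> N0; rewrite inE divfK ?intr_int // pnatr_eq0 -lt0n. Qed.

Lemma lattice_inv N : (0 < N)%N -> 1 / N%:R \in lattice N.
Proof. by move=> N0; rewrite inE divfK ?int_num1 // pnatr_eq0 -lt0n. Qed.

Lemma lattice_Zg (l : gint) N x : gdvd N l -> x \in lattice N -> Zg l x.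
Proof.
move=> lN /intrP[z xz]; exists z, N; split=> //.
by rewrite -xz mulfK // pnatr_eq0 -lt0n; case: lN.
Qed.

Lemma Zg_lattice (l : gint) x : Zg l x -> exists2 b, gdvd b l & x \in lattice b.
Proof. by move=> [z [b [lb ->]]]; exists b => //; case: lb => b0 _; exact: lattice_frac. Qed.

Lemma nat_above (x : rat) : exists n : nat, x < n%:R.
Proof.
exists (Num.Def.archi_bound `|x|).
exact: le_lt_trans (ler_norm x) (archi_boundP (normr_ge0 x)).
Qed.

(** This is the nontrivial half of the fact that [v/N + 1/(N r)] has order exactly [r] modulo
    (1/N)Z; clearing denominators gives [k = (z - v k) r]. *)
Lemma lattice_mul_order N r (v : int) (k : int) : (0 < N)%N -> (0 < r)%N ->
  (v%:~R / N%:R + 1 / (N * r)%:R) * k%:~R \in lattice N -> (r %| k)%Z.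
Proof.
move=> N0 r0 /intrP[z].
have Nn : N%:R != 0 :> rat by rewrite pnatr_eq0 -lt0n.
have rn : r%:R != 0 :> rat by rewrite pnatr_eq0 -lt0n.
rewrite natrM => H.
have {}H : k%:~R = ((z - v * k) * r%:Z)%:~R :> rat.
  rewrite rmorphM rmorphB rmorphM /= -H -pmulrn; field; exact/andP.
by move/intr_inj: H => ->; rewrite dvdz_mull.
Qed.


(** * Stages and their order *)

(* [top s i] is the current generator [d_i] of the interval attached to [q i]. *)
Record stage := Stage { den : nat; pos : rat -> Prop; top : nat -> rat }.

(** [top_avoid] keeps 1 out of the [t]-fold sum of the interval. The bound in [top_bounded] is
    uniform in [i], so one threshold lies above all elements to be avoided. *)
Record admissible (q : nat -> nat) (l : gint) (s : stage) : Prop := Admissible {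
  den_dvd : gdvd (den s) l;
  pos0 : pos s 0;
  posD : forall x y, pos s x -> pos s y -> pos s (x + y);
  pos_ge0 : forall x, pos s x -> 0 <= x;
  pos_lattice : forall x, pos s x -> x \in lattice (den s);
  pos_top : forall i, pos s (top s i);
  top_bounded : exists B, forall i, top s i *+ q i <= B;
  top_avoid : forall i t, (0 < t < q i)%N -> ~ pos s (top s i *+ t - 1) }.

(** This is what makes nonzero positive elements order-units in the limit. *)
Definition pos_cofinite (s : stage) : Prop :=
  exists C, forall x, x \in lattice (den s) -> C <= x -> pos s x.

Definition complete_stage q l s : Prop := admissible q l s /\ pos_cofinite s.

(** The last clause makes the successive tops an increasing chain for the limiting order. *)
Definition extends (s s' : stage) : Prop :=
  [/\ (den s %| den s')%N, (forall x, pos s x -> pos s' x) &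
      forall i, pos s' (top s' i - top s i)].

Lemma extends_refl q l s : admissible q l s -> extends s s.
Proof. by move=> [_ s0 _ _ _ _ _ _]; split=> // i; rewrite subrr. Qed.

Lemma extends_trans q l s1 s2 s3 :
  admissible q l s3 -> extends s1 s2 -> extends s2 s3 -> extends s1 s3.
Proof.
move=> a3 [d12 p12 t12] [d23 p23 t23]; split=> [|x|i]; first exact: dvdn_trans d23.
  by move=> /p12/p23.
rewrite -(subrK (top s2 i) (top s3 i)) -addrA.
by apply: (posD a3); [exact: t23|exact/p23/t12].
Qed.

Lemma posMn q l s x n : admissible q l s -> pos s x -> pos s (x *+ n).
Proof.
move=> a px; elim: n => [|n IH]; first by rewrite mulr0n; exact: pos0 a.
by rewrite mulrS; exact: (posD a px IH).
Qed.

(** * Extensions: completion, denominators, tops *)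

(* Adding every sufficiently large element of the lattice does no harm, since
   only the bounded elements [t d_i - 1] have to be avoided. *)
Lemma complete_extension q l s : admissible q l s ->
  exists s', [/\ complete_stage q l s', extends s s', den s' = den s & top s' = top s].
Proof.
move=> a; have [B leB] := top_bounded a.
(* Since [C] is nonnegative, adding a nonnegative element to one above [C] stays above [C]; since
   [C] exceeds [B], no [top s i *+ t - 1] reaches it. *)
pose C := `|B| + 1.
have C0 : 0 <= C by rewrite addr_ge0.
exists (Stage (den s) (fun x => x \in lattice (den s) /\ (pos s x \/ C <= x)) (top s)).
split=> //=; last first.
  split=> //= [x px|i]; first by split; [exact: (pos_lattice a px)|left].
  by rewrite subrr; split; [exact: rpred0|left; exact: pos0 a].
split; last by exists C => x xN leC; split; [|right].
split=> /=.
- exact: den_dvd a.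
- by split; [exact: rpred0|left; exact: pos0 a].
- move=> x y [xN px] [yN py]; split; first exact: rpredD.
  have ge0 z : pos s z \/ C <= z -> 0 <= z.
    by case; [exact: (pos_ge0 a)|exact: le_trans].
  have := ge0 _ px; have := ge0 _ py.
  case: px => [px|Cx]; last by right; lra.
  case: py => [py|Cy]; last by right; lra.
  by left; exact: (posD a).
- by move=> x [_ [/(pos_ge0 a)//|]]; exact: le_trans.
- by move=> x [].
- by move=> i; split; [exact: (pos_lattice a (pos_top a i))|left; exact: (pos_top a i)].
- by exists B.
- move=> i t tq [_ [|Ct]]; first exact: (top_avoid a tq).
  have le_t : top s i *+ t <= top s i *+ q i.
    by apply: ler_wpMn2l; [exact: (pos_ge0 a (pos_top a i))|case/andP: tq => _ /ltnW].
  have := leB i; have := ler_norm B; rewrite /C in Ct; lra.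
Qed.

(** Keeping the same cone in a finer lattice is admissible but may lose [pos_cofinite]; completion
    restores it. *)
Lemma extend_den q l s b : complete_stage q l s -> gdvd b l ->
  exists s', [/\ complete_stage q l s', extends s s', den s' = lcmn (den s) b & top s' = top s].
Proof.
move=> [a _] lb.
have dN : (den s %| lcmn (den s) b)%N by exact: dvdn_lcml.
have [|s' [cs' [d' p' t'] dE ts']] :=
  @complete_extension q l (Stage (lcmn (den s) b) (pos s) (top s)).
  split=> /=; try by case: a.
  - by apply: gdvd_lcm => //; exact: den_dvd a.
  - by move=> x px; apply: lattice_dvd dN _; exact: (pos_lattice a px).
exists s'; split=> //; split=> [|//|//]; exact: dvdn_trans dN d'.
Qed.

Lemma extend_top q l s i x : (0 < q i)%N ->
  (forall p, prime p -> (p %| q i)%N -> l p = None) ->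
  complete_stage q l s -> x \in lattice (den s) ->
  exists s', [/\ complete_stage q l s', extends s s' & pos s' (top s' i *+ q i - x)].
Proof.
move=> q0 ql [a [C cofC]] xN.
have N0 : (0 < den s)%N by case: (den_dvd a).
have Nn : (den s)%:R != 0 :> rat by rewrite pnatr_eq0 -lt0n.
have qn : (q i)%:R != 0 :> rat by rewrite pnatr_eq0 -lt0n.
have [K ltK] := nat_above (`|C| + `|x|).
(* The integer [K] makes [e] large enough for both [e *+ q i] and [e *+ q i - x] to lie above [C];
   the fraction gives [e] order [q i] modulo the lattice. *)
pose e : rat := (Posz (K * den s))%:~R / (den s)%:R + 1 / (den s * q i)%:R.
have eE : e = K%:R + 1 / ((den s)%:R * (q i)%:R).
  by rewrite /e -pmulrn !natrM mulfK.
have eq0 : 0 < 1 / ((den s)%:R * (q i)%:R) :> rat.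
  by rewrite divr_gt0 // mulr_gt0 ?ltr0n.
have eK : K%:R < e by rewrite eE ltrDl.
have e0 : 0 <= e by apply: le_trans (ltW eK).
have qeN : e *+ q i \in lattice (den s).
  rewrite eE mulrnDl rpredD //.
    by do 2!apply: rpredMn; exact: lattice1.
  have -> : 1 / ((den s)%:R * (q i)%:R) *+ q i = 1 / (den s)%:R :> rat.
    by rewrite -mulr_natr; field; exact/andP.
  exact: lattice_inv.
have le_eq : e <= e *+ q i by rewrite -{1}[e]mulr1n ler_wpMn2l.
have [nC nx] : C <= `|C| /\ x <= `|x| by rewrite !ler_norm.
have nx' := normr_ge0 x; have nC' := normr_ge0 C.
have pqe : pos s (e *+ q i) by apply: cofC => //; lra.
have pqex : pos s (e *+ q i - x) by apply: cofC; [exact: rpredB|lra].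
pose T w := exists u j, pos s u /\ w = u + e *+ j.
(* From [w + t e = u + j e] the order of [e] gives [j = t] modulo [q i]. As [t < q i] and [j] is a
   natural number, [j = t + q i * k], so [w] is [u] plus [k] copies of the old positive element
   [e *+ q i]. *)
have TS w t : w \in lattice (den s) -> (t < q i)%N -> T (w + e *+ t) -> pos s w.
  move=> wN tq [u [j [pu wE]]].
  have /(lattice_mul_order N0 q0) : e * (j%:Z - t%:Z)%:~R \in lattice (den s).
    have -> : e * (j%:Z - t%:Z)%:~R = w - u.
      rewrite rmorphB /= -!pmulrn mulrBr !mulr_natr.
      by apply/eqP; rewrite subr_eq -addrA -[_ + e *+ t]addrC addrA wE; apply/eqP; ring.
    by rewrite rpredB // (pos_lattice a).
  move=> /dvdzP[z jE].
  have [k jk] : exists k : nat, j = (t + q i * k)%N.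
    clear -jE tq; case: z jE => k jE; first by exists k; lia.
    by exfalso; rewrite NegzE in jE; nia.
  have -> : w = u + e *+ q i *+ k.
    by move: wE; rewrite jk mulrnDr mulrnA => wE; lra.
  by apply: (posD a) => //; exact: (posMn _ a).
pose d k := if k == i then top s i + e else top s k.
have ST w : pos s w -> T w by exists w, 0%N; rewrite mulr0n addr0.
have dN' : (den s %| den s * q i)%N by exact: dvdn_mulr.
have Te : T e by exists 0, 1%N; rewrite mulr1n add0r; split=> //; exact: pos0 a.
have TD u v : T u -> T v -> T (u + v).
  move=> [u1 [j1 [p1 ->]]] [u2 [j2 [p2 ->]]]; exists (u1 + u2), (j1 + j2)%N.
  by split; [exact: (posD a)|rewrite mulrnDr addrACA].
have [|s' [cs' [d' p' t'] _ ts']] := @complete_extension q l (Stage (den s * q i) T d).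
  split=> /=.
  - by apply: gdvd_mul_infinite => //; exact: den_dvd a.
  - exact/ST/(pos0 a).
  - exact: TD.
  - move=> w [u [j [pu ->]]]; rewrite addr_ge0 ?mulrn_wge0 //; exact: (pos_ge0 a pu).
  - move=> w [u [j [pu ->]]]; rewrite rpredD ?rpredMn //.
      by apply: lattice_dvd dN' _; exact: (pos_lattice a pu).
    apply: rpredD; last by apply: lattice_inv; rewrite muln_gt0 N0.
    by apply: lattice_dvd dN' _; exact: lattice_frac.
  - move=> k; rewrite /d; case: eqP => _; last exact/ST/(pos_top a).
    by apply: TD => //; exact/ST/(pos_top a).
  - have [B leB] := top_bounded a; exists (B + e *+ q i) => k; rewrite /d.
    case: eqP => [->|_]; first by rewrite mulrnDl lerD2r.
    by apply: le_trans (leB k) _; rewrite lerDl; exact: (pos_ge0 a pqe).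
  - have tN k t : top s k *+ t - 1 \in lattice (den s).
      by rewrite rpredB ?lattice1 ?rpredMn //; exact: (pos_lattice a (pos_top a k)).
    (* For [k = i] the element is [(top s i *+ t - 1) + e *+ t], and [TS] is applied with [t]; for
       other indices it is applied with 0. *)
    move=> k t; rewrite /d; case: eqP => [->|_] tq.
      rewrite mulrnDl addrAC => /TS H; apply: (top_avoid a tq); apply: H => //.
      by case/andP: tq.
    move=> Tk; apply: (top_avoid a tq); apply: (@TS _ 0%N) => //.
    by rewrite mulr0n addr0.
exists s'; split=> //=.
  split; first exact: dvdn_trans dN' d'.
    by move=> w /ST/p'.
  move=> k; rewrite ts' /= /d; apply: p'; case: eqP => [->|_].
    by rewrite addrC addKr.
  by rewrite subrr; exact/ST/(pos0 a).
rewrite ts' /= /d eqxx mulrnDl -addrA; apply/p'/ST/(posD a) => //.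
exact: (posMn _ a (pos_top a i)).
Qed.

(** * Refinement of inequalities *)

(* [a, x - a, y1 - a, y2 - x + a] are the entries of a refinement matrix with row
   sums [x, y1 + y2 - x] and column sums [y1, y2]. *)
Definition corner_sum (x y1 y2 a : rat) (n1 n2 n3 n4 : nat) : rat :=
  a *+ n1 + (x - a) *+ n2 + (y1 - a) *+ n3 + (y2 - x + a) *+ n4.

Lemma corner_sumD x y1 y2 a n1 n2 n3 n4 m1 m2 m3 m4 :
  corner_sum x y1 y2 a n1 n2 n3 n4 + corner_sum x y1 y2 a m1 m2 m3 m4 =
  corner_sum x y1 y2 a (n1 + m1) (n2 + m2) (n3 + m3) (n4 + m4).
Proof. by rewrite /corner_sum !mulrnDr; ring. Qed.

(** When the total coefficient of [a] vanishes, the entries can be paired along rows and columns so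
    that [a] cancels. This form covers [n1 <= n2], the next one [n2 <= n1]. *)
Lemma corner_sum_balanced_l x y1 y2 a n k m :
  corner_sum x y1 y2 a n (k + n) m (k + m) = x *+ n + y2 *+ k + (y1 + y2 - x) *+ m.
Proof. by rewrite /corner_sum; ring. Qed.

Lemma corner_sum_balanced_r x y1 y2 a n k m :
  corner_sum x y1 y2 a (k + n) n (k + m) m = x *+ n + y1 *+ k + (y1 + y2 - x) *+ m.
Proof. by rewrite /corner_sum; ring. Qed.

(** Isolates the multiple of [a], so that the order of [a] constrains the imbalance of any corner
    sum lying in the lattice. *)
Lemma corner_sum_coef x y1 y2 a n1 n2 n3 n4 :
  a * ((n1 + n4)%:Z - (n2 + n3)%:Z)%:~R =
  corner_sum x y1 y2 a n1 n2 n3 n4 - x *+ n2 - y1 *+ n3 - (y2 - x) *+ n4.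
Proof. by rewrite /corner_sum rmorphB /= -!pmulrn; ring. Qed.

Definition refines (s : stage) (x y1 y2 : rat) : Prop :=
  exists x1 x2, [/\ pos s x1, pos s x2, pos s (y1 - x1), pos s (y2 - x2) & x = x1 + x2].

Lemma corner_sum_lattice N x y1 y2 a n1 n2 n3 n4 :
  x \in lattice N -> y1 \in lattice N -> y2 \in lattice N -> a \in lattice N ->
  corner_sum x y1 y2 a n1 n2 n3 n4 \in lattice N.
Proof. by move=> *; rewrite /corner_sum !(rpredB, rpredMn, rpredD). Qed.

Lemma extend_refines_pos q l s x y1 y2 : gint_infinite l -> complete_stage q l s ->
  pos s x -> pos s y1 -> pos s y2 -> pos s (y1 + y2 - x) ->
  0 < x -> 0 < y1 -> 0 < y2 -> 0 < y1 + y2 - x ->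
  exists s', [/\ complete_stage q l s', extends s s' & refines s' x y1 y2].
Proof.
move=> linf cs px py1 py2 pz x0 y10 y20 z0.
(* The four matrix entries are positive exactly when [a] lies strictly between [lo] and [hi]. *)
pose lo := Num.max 0 (x - y2); pose hi := Num.min x y1.
have lohi : lo < hi.
  by rewrite /lo /hi gt_max !lt_min; apply/andP; split; apply/andP; split; lra.
have [lo0 lox] : 0 <= lo /\ x - y2 <= lo by rewrite /lo !le_max !lexx orbT.
have [hix hiy] : hi <= x /\ hi <= y1 by rewrite /hi !ge_min !lexx orbT.
move: lo hi lohi lo0 lox hix hiy => lo hi lohi lo0 lox hix hiy.
(* Of the four quarters, the outer two are margins bounding every entry below by [dl]; the others
   absorb rounding to the lattice and the shift by [1/(N r)]. *)
pose dl := (hi - lo) / 4%:R.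
have dl0 : 0 < dl by rewrite /dl; lra.
have hiE : hi = lo + dl + dl + dl + dl by rewrite /dl; lra.
(* The lattice is first refined until its mesh is at most [dl]. *)
have [r0 ltr0] := nat_above (1 / dl).
have [r1 lt01 l1] := gdvd_mul_large r0 linf (den_dvd cs.1).
have [s1 [[a c1] e1 dE tE]] := extend_den cs l1.
have {cs} [d01 p01 t01] := e1.
move/p01: px => px; move/p01: py1 => py1; move/p01: py2 => py2; move/p01: pz => pz.
have N0 : (0 < den s1)%N by case: (den_dvd a).
have Nn : 0 < (den s1)%:R :> rat by rewrite ltr0n.
have Ndl : 1 / (den s1)%:R <= dl.
  rewrite ler_pdivrMr // mulrC -ler_pdivrMr // (le_trans (ltW ltr0)) // ler_nat dE.
  have : (r1 %| lcmn (den s) (den s * r1))%N.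
    by apply: dvdn_trans (dvdn_lcmr _ _); exact: dvdn_mull.
  by move=> /dvdn_leq; rewrite -dE => /(_ N0); clear -lt01; lia.
have [B leB] := top_bounded a.
(* With [r] this large, a sum of [r] or more entries is at least [B], above every element to be
   avoided. *)
have [r2 ltr2] := nat_above (B / dl).
have [r lt2r lr] := gdvd_mul_large r2 linf (den_dvd a).
have r0' : (0 < r)%N by clear -lt2r; lia.
have rB : B <= r%:R * dl.
  rewrite -ler_pdivrMr // (le_trans (ltW ltr2)) // ler_nat; exact: ltnW.
pose v := Num.floor ((lo + dl) * (den s1)%:R) + 1.
pose aa : rat := v%:~R / (den s1)%:R + 1 / (den s1 * r)%:R.
have [aalo aahi] : lo + dl <= aa /\ aa <= hi - dl.
  have := floor_le ((lo + dl) * (den s1)%:R).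
  have := floorD1_gt ((lo + dl) * (den s1)%:R).
  rewrite -/v -ltr_pdivlMr // => lov.
  rewrite -ler_pdivrMr // => flo.
  have vE : v%:~R / (den s1)%:R =
    (Num.floor ((lo + dl) * (den s1)%:R))%:~R / (den s1)%:R + 1 / (den s1)%:R :> rat.
    by rewrite rmorphD mulrDl.
  have : 1 / (den s1 * r)%:R <= 1 / (den s1)%:R :> rat.
    rewrite ler_pM2l // lef_pV2 ?posrE ?ltr0n ?muln_gt0 ?N0 // ler_nat.
    by rewrite leq_pmulr.
  have : 0 <= 1 / (den s1 * r)%:R :> rat by rewrite divr_ge0 ?ler0n.
  by rewrite /aa; lra.
have [a1 a2 a3 a4] : [/\ dl <= aa, dl <= x - aa, dl <= y1 - aa & dl <= y2 - x + aa].
  by split; lra.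
pose gen n1 n2 n3 n4 := corner_sum x y1 y2 aa n1 n2 n3 n4.
have gen_ge n1 n2 n3 n4 : dl *+ (n1 + n2 + n3 + n4) <= gen n1 n2 n3 n4.
  by rewrite /gen /corner_sum !mulrnDr !lerD // lerMn2r ?a1 ?a2 ?a3 ?a4 orbT.
(* Balanced combinations of the four generators are combinations of their
   row and column sums, which already lie in the stage. *)
have gen_balanced n1 n2 n3 n4 : (n1 + n4 = n2 + n3)%N -> pos s1 (gen n1 n2 n3 n4).
  have [/subnK|/ltnW/subnK] := leqP n1 n2.
    move: (n2 - n1)%N => k <- bal.
    have -> : n4 = (k + n3)%N by clear -bal; lia.
    rewrite /gen corner_sum_balanced_l.
    by do 2?[apply: (posD a)]; exact: posMn _ a _.
  move: (n1 - n2)%N => k <- bal.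
  have -> : n3 = (k + n4)%N by clear -bal; lia.
  rewrite /gen corner_sum_balanced_r.
  by do 2?[apply: (posD a)]; exact: posMn _ a _.
pose T w := exists u n1 n2 n3 n4, pos s1 u /\ w = u + gen n1 n2 n3 n4.
(* Below [B] fewer than [r] entries occur. Their imbalance is divisible by [r] and smaller than [r]
   in absolute value, hence zero. *)
have TS w : w \in lattice (den s1) -> w < B -> T w -> pos s1 w.
  move=> wN wB [u [n1 [n2 [n3 [n4 [pu wE]]]]]].
  have gw : gen n1 n2 n3 n4 <= w by rewrite wE lerDr; exact: (pos_ge0 a pu).
  have ltn : (n1 + n2 + n3 + n4 < r)%N.
    rewrite ltnNge; apply/negP => ler_n.
    have : dl *+ r <= dl *+ (n1 + n2 + n3 + n4) by apply: ler_wpMn2l => //; exact: ltW.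
    rewrite -mulr_natl; have := gen_ge n1 n2 n3 n4; clear -gw wB rB; lra.
  have /(lattice_mul_order N0 r0') :
      aa * ((n1 + n4)%:Z - (n2 + n3)%:Z)%:~R \in lattice (den s1).
    have -> : aa * ((n1 + n4)%:Z - (n2 + n3)%:Z)%:~R =
        w - u - x *+ n2 - y1 *+ n3 - (y2 - x) *+ n4.
      by rewrite wE [u + _]addrC addrK; exact: corner_sum_coef.
    have := pos_lattice a px; have := pos_lattice a py1.
    have := pos_lattice a py2; have := pos_lattice a pu.
    by move=> *; rewrite !(rpredB, rpredMn).
  move=> /dvdzP[k kE].
  rewrite wE; apply: (posD a) => //; apply: gen_balanced.
  by clear -kE ltn r0'; case: k kE => -[|k] kE; rewrite ?NegzE in kE; nia.
have ST w : pos s1 w -> T w.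
  by exists w, 0%N, 0%N, 0%N, 0%N; rewrite /gen /corner_sum !mulr0n !addr0.
have Tg n1 n2 n3 n4 : T (gen n1 n2 n3 n4).
  by exists 0, n1, n2, n3, n4; rewrite add0r; split=> //; exact: pos0 a.
have dN' : (den s1 %| den s1 * r)%N by exact: dvdn_mulr.
have ST_lat w : pos s1 w -> w \in lattice (den s1 * r).
  by move=> pw; apply: lattice_dvd dN' _; exact: (pos_lattice a pw).
have aaN : aa \in lattice (den s1 * r).
  apply: rpredD; last by apply: lattice_inv; rewrite muln_gt0 N0.
  by apply: lattice_dvd dN' _; exact: lattice_frac.
have [|s' [cs' [d' p' t'] _ ts']] := @complete_extension q l (Stage (den s1 * r) T (top s1)).
  split=> //=.
  - exact/ST/(pos0 a).
  - move=> w1 w2 [u [n1 [n2 [n3 [n4 [pu ->]]]]]] [u' [m1 [m2 [m3 [m4 [pu' ->]]]]]].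
    rewrite addrACA corner_sumD; do 5!eexists; split; last by [].
    exact: (posD a).
  - move=> w [u [n1 [n2 [n3 [n4 [pu ->]]]]]].
    by rewrite addr_ge0 ?(pos_ge0 a pu) // (le_trans _ (gen_ge _ _ _ _)) // mulrn_wge0 // ltW.
  - move=> w [u [n1 [n2 [n3 [n4 [pu ->]]]]]].
    have := ST_lat _ px; have := ST_lat _ py1; have := ST_lat _ py2; have := ST_lat _ pu.
    by move=> uN xN2 xN1 xN; rewrite rpredD //; exact: corner_sum_lattice.
  - by move=> i; exact/ST/(pos_top a).
  - by exists B.
  - move=> i t tq; have := top_avoid a tq => av Tt; apply: av; apply: TS Tt.
      by rewrite rpredB ?lattice1 ?rpredMn //; exact: (pos_lattice a (pos_top a i)).
    have : top s1 i *+ t <= top s1 i *+ q i.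
      by apply: ler_wpMn2l; [exact: (pos_ge0 a (pos_top a i))|case/andP: tq => _ /ltnW].
    have := leB i; clear; lra.
exists s'; split=> //.
  split; first exact: dvdn_trans d01 (dvdn_trans dN' d').
    by move=> w /p01/ST/p'.
  by move=> i; rewrite ts' /=; apply/p'/ST.
exists aa, (x - aa); split; last by rewrite addrC subrK.
- by have := p' _ (Tg 1 0 0 0)%N; rewrite /gen /corner_sum !mulr0n mulr1n !addr0.
- by have := p' _ (Tg 0 1 0 0)%N; rewrite /gen /corner_sum !mulr0n mulr1n !addr0 add0r.
- by have := p' _ (Tg 0 0 1 0)%N; rewrite /gen /corner_sum !mulr0n mulr1n !addr0 !add0r.
- rewrite opprB addrA addrAC.
  by have := p' _ (Tg 0 0 0 1)%N; rewrite /gen /corner_sum !mulr0n mulr1n !add0r.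
Qed.

(** If one of [x], [y1], [y2], [y1 + y2 - x] vanishes, the refinement already exists in [s];
    otherwise all four are strictly positive. *)
Lemma extend_refines q l s x y1 y2 : gint_infinite l -> complete_stage q l s ->
  pos s x -> pos s y1 -> pos s y2 -> pos s (y1 + y2 - x) ->
  exists s', [/\ complete_stage q l s', extends s s' & refines s' x y1 y2].
Proof.
move=> linf cs px py1 py2 pz; have a := cs.1.
have [|nr] := classic (refines s x y1 y2); first by exists s; split=> //; exact: extends_refl a.
have p0 := pos0 a.
have gt0 w : pos s w -> w != 0 -> 0 < w.
  by move=> pw w0; rewrite lt_def w0 (pos_ge0 a pw).
apply: extend_refines_pos => //; apply: gt0 => //; apply/eqP => E; apply: nr.
- by exists 0, 0; rewrite !subr0 ?addr0.
- by exists 0, x; rewrite subr0 add0r; split=> //; move: pz; rewrite E add0r.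
- by exists x, 0; rewrite subr0 addr0; split=> //; move: pz; rewrite E addr0.
- by exists y1, y2; rewrite !subrr; split=> //; move/eqP: E; rewrite subr_eq0 => /eqP.
Qed.

(** * Scheduling the tasks *)

Lemma dependent_choice (A : Type) (W : A -> Prop) (R : nat -> A -> A -> Prop) (a0 : A) :
  W a0 -> (forall n a, W a -> exists b, W b /\ R n a b) ->
  exists s : nat -> A, [/\ s 0%N = a0, forall n, W (s n) & forall n, R n (s n) (s n.+1)].
Proof.
move=> W0 step.
have next n (a : {a | W a}) : {b : {b | W b} | R n (sval a) (sval b)}.
  apply: constructive_indefinite_description; case: a => a Wa.
  by have [b [Wb Rab]] := step n a Wa; exists (exist _ b Wb).
pose s := fix s n := if n is m.+1 then sval (next m (s m)) else exist _ a0 W0.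
exists (fun n => sval (s n)); split=> // n; first exact: svalP (s n).
exact: svalP (next n (s n)).
Qed.

Definition task : countType := (rat + rat * rat * rat + nat * rat)%type.

(** Preconditions on positivity or on the lattice refer to the earlier stage, so a task met too
    early is vacuous; hence each task must recur arbitrarily late. *)
Definition achieved (q : nat -> nat) (l : gint) (c : task) (s s' : stage) : Prop :=
  match c with
  | inl (inl x) => Zg l x -> x \in lattice (den s')
  | inl (inr (x, y1, y2)) =>
      pos s x -> pos s y1 -> pos s y2 -> pos s (y1 + y2 - x) -> refines s' x y1 y2
  | inr (i, x) => x \in lattice (den s) -> pos s' (top s' i *+ q i - x)
  end.

Lemma achieve q l c s : gint_infinite l -> (forall i, (0 < q i)%N) ->
  (forall i p, prime p -> (p %| q i)%N -> l p = None) -> complete_stage q l s ->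
  exists s', complete_stage q l s' /\ (extends s s' /\ achieved q l c s s').
Proof.
move=> linf q0 ql cs; have id_s := extends_refl cs.1.
case: c => [[x|[[x y1] y2]]|[i x]] /=.
- have [/Zg_lattice[b lb xb]|] := classic (Zg l x); last by exists s.
  have [s' [cs' e dE _]] := extend_den cs lb.
  by exists s'; split=> //; split=> // _; rewrite dE; apply: lattice_dvd xb; exact: dvdn_lcmr.
- have [[px [py1 [py2 pz]]]|np] :=
    classic (pos s x /\ pos s y1 /\ pos s y2 /\ pos s (y1 + y2 - x)).
    by have [s' [cs' e r]] := extend_refines linf cs px py1 py2 pz; exists s'.
  by exists s; split=> //; split=> // *; case: np.
- have [xN|nx] := boolP (x \in lattice (den s)); last by exists s.
  by have [s' [cs' e r]] := extend_top (q0 i) (ql i) cs xN; exists s'.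
Qed.

(** Start from the integers with their usual order and all tops 0, so that [top s i *+ t - 1] is
    -1. *)
Lemma initial_stage q l : (forall i, (0 < q i)%N) ->
  exists s, complete_stage q l s /\ pos s 1.
Proof.
move=> q0.
exists (Stage 1 (fun x => x \in lattice 1 /\ 0 <= x) (fun=> 0)); split; last first.
  by split=> //; exact: lattice1.
have lat0 : 0 \in lattice 1 by exact: rpred0.
split; last by exists 0.
split=> //=.
- exact: gdvd1.
- by move=> x y [xN x0] [yN y0]; split; [exact: rpredD|exact: addr_ge0].
- by move=> x [].
- by move=> x [].
- by exists 0 => i; rewrite mul0rn.
- by move=> i t _ []; rewrite mul0rn sub0r.
Qed.

(** Step [n] treats the task coded by the 2-adic valuation of [n]; every valuation occurs at
    arbitrarily large [n], for instance at [2 ^ pickle c] times an odd number. *)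
Lemma stage_sequence q l : gint_infinite l -> (forall i, (0 < q i)%N) ->
  (forall i p, prime p -> (p %| q i)%N -> l p = None) ->
  exists st : nat -> stage,
    [/\ forall n, complete_stage q l (st n), pos (st 0%N) 1,
        forall m n, (m <= n)%N -> extends (st m) (st n) &
        forall c N, exists2 n, (N <= n)%N & achieved q l c (st n) (st n.+1)].
Proof.
move=> linf q0 ql; have [s0 [cs0 s01]] := initial_stage l q0.
pose R n s s' := extends s s' /\
  (forall c, unpickle (logn 2 n) = Some c -> achieved q l c s s').
have [n s cs|st [st0 cst Rst]] := @dependent_choice _ (complete_stage q l) R s0 cs0.
  case E: (unpickle (logn 2 n)) => [c|].
    have [s' [cs' [e ac]]] := achieve c linf q0 ql cs; exists s'; split=> //; split=> // c'.
    by rewrite E => -[<-].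
  by exists s; split=> //; split; [exact: extends_refl cs.1|rewrite E].
exists st; split=> // [|m n|c N]; first by rewrite st0.
  move=> /subnK <-; elim: (n - m)%N => [|k IH]; first exact: extends_refl (cst m).1.
  exact: extends_trans (cst _).1 IH (Rst _).1.
exists (2 ^ pickle c * (N.*2).+1)%N.
  apply: leq_trans (leq_pmull _ _); last by rewrite expn_gt0.
  by rewrite -addnn; lia.
apply: (Rst _).2; rewrite lognM ?expn_gt0 // lognX logn_prime // muln1.
by rewrite lognE dvdn2 /= odd_double /= addn0 pickleK.
Qed.

(** * Intervals generated by increasing sequences *)

Section Chain.
Variables (G : zmodType) (P : G -> Prop) (d : nat -> G).
Hypotheses (P_cone : is_cone P) (Pd : forall n, P (d n))
  (d_mono : forall m n, (m <= n)%N -> P (d n - d m)).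

Definition chain_hull (z : G) : Prop := P z /\ exists n, pleq P z (d n).

Lemma coneMn x n : P x -> P (x *+ n).
Proof.
case: P_cone => P0 PD _ Px; elim: n => [|n IH]; first by rewrite mulr0n.
by rewrite mulrS; exact: PD.
Qed.

Lemma pleq_trans x y z : pleq P x y -> pleq P y z -> pleq P x z.
Proof. by case: P_cone => _ PD _ xy yz; rewrite /pleq -(subrK y z) -addrA; exact: PD. Qed.

Lemma chain_hull_interval : pog_interval P chain_hull.
Proof.
have [P0 PD _] := P_cone; split.
- by move=> x [].
- by exists (d 0%N); split=> //; exists 0%N; exact: d_mono.
- move=> x y [_ [m xm]] [_ [n yn]]; exists (d (maxn m n)); split.
  + by split=> //; exists (maxn m n); exact: d_mono.
  + by apply: pleq_trans xm _; apply: d_mono; exact: leq_maxl.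
  + by apply: pleq_trans yn _; apply: d_mono; exact: leq_maxr.
- move=> z x Pz zx [_ [n xn]]; split=> //; exists n; exact: pleq_trans zx xn.
Qed.

Lemma chain_hull_countably_generated : countably_generated P chain_hull.
Proof.
exists d; split=> [n|x [_ //]]; split=> //; exists n; exact: d_mono.
Qed.

(** Since the sequence increases, the indices of the [t] summands can be replaced by their
    maximum. *)
Lemma tmul_chain_hull t z : (0 < t)%N ->
  tmul P t chain_hull z <-> P z /\ exists n, pleq P z (d n *+ t).
Proof.
have [P0 PD _] := P_cone.
case: t => // t _; elim: t z => [|t IH] z; first by [].
split=> [[Pz [x [y [[Px [m xm]] /IH[Py [n yn]] zxy]]]]|[Pz [n zn]]].
  split=> //; exists (maxn m n); apply: pleq_trans zxy _.
  rewrite /pleq mulrS opprD addrACA; apply: PD.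
    by apply: pleq_trans xm _; apply: d_mono; exact: leq_maxl.
  apply: pleq_trans yn _; rewrite /pleq -mulrnBl; apply: coneMn.
  by apply: d_mono; exact: leq_maxr.
split=> //; exists (d n), (d n *+ t.+1); split; last by rewrite -mulrS.
  by split=> //; exists n; exact: d_mono.
by apply/IH; split; [exact: coneMn|exists n; rewrite /pleq subrr].
Qed.

End Chain.

(** * The group of rationals with denominator dividing [l] *)

(** A boolean form of [Zg], so that the subtype inherits its group structure from [rat]. *)
Definition in_Zg (l : gint) : {pred rat} :=
  [pred x | if excluded_middle_informative (Zg l x) then true else false].

Lemma in_ZgP l x : reflect (Zg l x) (x \in in_Zg l).
Proof. by rewrite inE; case: excluded_middle_informative => ?; constructor. Qed.

Lemma in_Zg_zmod_closed l : zmod_closed (in_Zg l).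
Proof.
split=> [|x y /in_ZgP/Zg_lattice[b lb xb] /in_ZgP/Zg_lattice[c lc yc]]; apply/in_ZgP.
  by apply: lattice_Zg (gdvd1 l) _; exact: rpred0.
apply: lattice_Zg (gdvd_lcm lb lc) _; apply: rpredB.
  by apply: lattice_dvd xb; exact: dvdn_lcml.
by apply: lattice_dvd yc; exact: dvdn_lcmr.
Qed.

HB.instance Definition _ l := GRing.isZmodClosed.Build rat (in_Zg l) (in_Zg_zmod_closed l).

Record Zg_group (l : gint) := ZgGroup { Zg_val : rat; Zg_valP : Zg_val \in in_Zg l }.

HB.instance Definition _ l := [isSub of Zg_group l for @Zg_val l].
HB.instance Definition _ l := [Choice of Zg_group l by <:].
HB.instance Definition _ l := [SubChoice_isSubZmodule of Zg_group l by <:].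

(** * The limit group and its intervals *)

Theorem theorem3p4 (q : nat -> nat) (a : nat -> nat) :
  (forall i j, i <> j -> coprime (q i) (q j)) ->
  (forall j, exists i, a j = q i) ->
  (forall i N, exists j, (N <= j)%N /\ a j = q i) ->
  forall m : gint, gint_infinite m -> gint_coprime m (gint_inf_prod q) ->
  exists (G : zmodType) (P : G -> Prop),
    [/\ is_cone P, simple_pog P, riesz P, rank_one G &
      (
        (forall i, exists D : G -> Prop,
            [/\ pog_interval P D, countably_generated P D,
                (forall t, (0 < t)%N -> (t <= q i - 1)%N -> ~ same_set (tmul P t D) P) &
                same_set (tmul P (q i) D) P])
      /\ iso_Zg G (gint_mul (gint_inf_prod q) m))].
Proof.
move=> _ _ _ m minf mq.
have q_inf i p : (p %| q i)%N -> gint_inf_prod q p = None.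
  by move=> pq; rewrite /gint_inf_prod; case: excluded_middle_informative => // -[]; exists i.
(* If [q i = 0], every prime divides it, so coprimality forces all exponents of [m] to be 0, against
   its infinitude. *)
have q_gt0 i : (0 < q i)%N.
  rewrite lt0n; apply/eqP => qi0; apply: minf.
  have m0 p : prime p -> m p = Some 0%N.
    by move=> pp; case: (mq p pp) => //; rewrite (q_inf i) // qi0 dvdn0.
  by split=> [p pp|]; [rewrite m0|exists 0%N => p pp _; exact: m0].
set l := gint_mul _ m.
have ql i p : prime p -> (p %| q i)%N -> l p = None.
  by move=> _ /q_inf; rewrite /l /gint_mul => ->.
have linf : gint_infinite l.
  move=> [lfin [N lN]]; apply: minf; split=> [p pp mp|].
    by apply: (lfin p pp); rewrite /l /gint_mul mp; case: (gint_inf_prod q p).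
  exists N => p pp Np; have := lN p pp Np; rewrite /l /gint_mul.
  by case: (gint_inf_prod q p) => // k; case: (m p) => // k' -[]; case: k'; [|lia].
have [st [cst pos1 ext task_done]] := stage_sequence linf q_gt0 ql.
pose pr (x : rat) := exists n, pos (st n) x.
have pr_at x y : pr x -> pr y -> exists n, pos (st n) x /\ pos (st n) y.
  move=> [i xi] [j yj]; exists (maxn i j).
  have [_ pi _] := ext _ _ (leq_maxl i j); have [_ pj _] := ext _ _ (leq_maxr i j).
  by split; [exact: pi|exact: pj].
have prD x y : pr x -> pr y -> pr (x + y).
  by move=> px /(pr_at _ _ px)[n [xn yn]]; exists n; exact: (posD (cst n).1).
have pr_ge0 x : pr x -> 0 <= x by move=> [n]; exact: (pos_ge0 (cst n).1).
have in_lattice x : Zg l x -> exists n, forall k, (n <= k)%N -> x \in lattice (den (st k)).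
  move=> lx; have [n _ /(_ lx) xn] := task_done (inl (inl x)) 0%N.
  by exists n.+1 => k /ext[d _ _]; exact: lattice_dvd xn.
have pr_Zg x : pr x -> x \in in_Zg l.
  move=> [n xn]; apply/in_ZgP; apply: lattice_Zg (den_dvd (cst n).1) _.
  exact: (pos_lattice (cst n).1).
pose P (x : Zg_group l) := pr (val x).
have P_cone : is_cone P.
  split; first by exists 0%N; exact: (pos0 (cst 0%N).1).
    by move=> x y; exact: prD.
  move=> x /pr_ge0 x0 /pr_ge0; rewrite /= oppr_ge0 => x0'.
  by apply: val_inj; apply/eqP; rewrite eq_le x0 x0'.
have pr1 : pr 1 by exists 0%N.
pose one : Zg_group l := ZgGroup (pr_Zg _ pr1).
have pr_top n i : pr (top (st n) i) by exists n; exact: (pos_top (cst n).1).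
pose d i n : Zg_group l := ZgGroup (pr_Zg _ (pr_top n i)).
exists (Zg_group l), P; split=> //.
- split; first by exists one => /(congr1 (@Zg_val l)).
  move=> u [n un] u0; split; first by exists n.
  move=> x; have [N xN] := in_lattice _ (elimT (in_ZgP _ _) (Zg_valP x)).
  pose k := maxn n N; have [C cofC] := (cst k).2.
  have [_ pnk _] := ext _ _ (leq_maxl n N).
  have u_gt0 : 0 < Zg_val u.
    rewrite lt_def (pos_ge0 (cst n).1 un) andbT; apply/eqP => uz.
    by apply: u0; exact: val_inj.
  (* At stage [k], where [u] is positive and [x] is in the lattice, this [j] puts [u *+ j - x] above
     the threshold [C]. *)
  have [j ltj] := nat_above ((C + Zg_val x) / Zg_val u).
  exists j, k; rewrite raddfB raddfMn /=; apply: cofC.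
    apply: rpredB; last by apply: xN; exact: leq_maxr.
    by apply: rpredMn; apply: (pos_lattice (cst k).1); exact: pnk.
  by move: ltj; rewrite ltr_pdivrMr // mulr_natl => /ltW; rewrite lerBrDr.
- move=> x y1 y2 Px Py1 Py2 Pz.
  have [n1 [xn1 y1n1]] := pr_at _ _ Px Py1.
  have [n2 [y2n2 zn2]] := pr_at _ _ Py2 Pz.
  (* The refinement task is taken at a stage where all its hypotheses are already visible. *)
  have [n len done] := task_done (inl (inr (val x, val y1, val y2))) (maxn n1 n2).
  have [_ p1 _] := ext _ _ (leq_trans (leq_maxl n1 n2) len).
  have [_ p2 _] := ext _ _ (leq_trans (leq_maxr n1 n2) len).
  have [||||x1 [x2 [px1 px2 py1 py2 xE]]] := done; first exact: p1.
  + exact: p1.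
  + exact: p2.
  + by have := p2 _ zn2; rewrite raddfB raddfD.
  have prx1 : pr x1 by exists n.+1.
  have prx2 : pr x2 by exists n.+1.
  exists (ZgGroup (pr_Zg _ prx1)), (ZgGroup (pr_Zg _ prx2)); split=> //.
  + by exists n.+1; rewrite raddfB.
  + by exists n.+1; rewrite raddfB.
  + exact: val_inj.
- by exists val; split; [move=> x y; rewrite raddfD|exact: val_inj|exists one].
split; last first.
  exists val; split; [by move=> x y; rewrite raddfD|exact: val_inj|] => r.
  split=> [/in_ZgP rl|[x <-]]; first by exists (ZgGroup rl).
  exact/in_ZgP/Zg_valP.
move=> i; have d_mono k n : (k <= n)%N -> P (d i n - d i k).
  by move=> /ext[_ _ dk]; exists n; rewrite raddfB; exact: dk.
have Pd n : P (d i n) by exact: pr_top.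
have tmulE := tmul_chain_hull P_cone Pd d_mono.
exists (chain_hull P (d i)); split.
- exact: (chain_hull_interval P_cone Pd d_mono).
- exact: (chain_hull_countably_generated Pd d_mono).
(* The element 1 separates the two sets: if it lay below [d i n *+ t], then at a common later stage
   it would lie below [t] times the larger top, against [top_avoid]. *)
- move=> t t0 tq /(_ one)[_ /(_ pr1)].
  move=> /(tmulE _ _ t0)[_ [n [k]]].
  rewrite raddfB raddfMn /= => pk.
  have [_ pnk _] := ext _ _ (leq_maxl k n).
  have [_ _ dn] := ext _ _ (leq_maxr k n).
  have atq : (0 < t < q i)%N by rewrite t0 /=; have := q_gt0 i; lia.
  apply: (top_avoid (cst (maxn k n)).1 atq).
  have -> : top (st (maxn k n)) i *+ t - 1 = 
      (top (st n) i *+ t - 1) + (top (st (maxn k n)) i - top (st n) i) *+ t.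
    by rewrite mulrnBl; ring.
  by apply: (posD (cst _).1); [exact: pnk|apply: (posMn _ (cst _).1); exact: dn].
- move=> z; split=> [/(tmulE _ _ (q_gt0 i))[]//|Pz].
  apply/(tmulE _ _ (q_gt0 i)); split=> //.
  have [N zN] := in_lattice _ (elimT (in_ZgP _ _) (Zg_valP z)).
  (* The task is taken after [z] has entered the lattice, so that it is not vacuous. *)
  have [n /zN zn /(_ zn) pn] := task_done (inr (i, val z)) N.
  by exists n.+1, n.+1; rewrite raddfB raddfMn.
Qed.
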